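(* For every $z\ge1$, $\mathrm{TD}(\mathrm{QR}^z_{\infty,1,cf})=\mathrm{PBTD}(\mathrm{QR}^z_{\infty,1,cf})=0$. Moreover, if $m\ge2$ and $z=|\Sigma|\ge4m^2+1$, then $\mathrm{PBTD}(\mathrm{QR}^z_{\infty,m,cf})=1$.
   Context: Fix a countably infinite set $X$ of variables and an alphabet $\Sigma$ (finite or countably infinite, disjoint from $X$), $z=|\Sigma|$. A pattern is a nonempty finite string over $X\cup\Sigma$; it is constant-free if it contains no letters of $\Sigma$. A substitution is a morphism $h:(X\cup\Sigma)^*\to\Sigma^*$ fixing letters; $L(\pi)$ (erasing pattern language) is the set of all $h(\pi)$; patterns with equal languages are identified. A pattern is $m$-quasi-regular if every variable occurring in it occurs exactly $m$ times; $\mathrm{QR}^z_{\infty,m,cf}$ is the class of constant-free $m$-quasi-regular patterns over an alphabet of size $z$. A labelled example is $(w,\pm)$ with $w\in\Sigma^*$; a teaching set for $\pi$ w.r.t. a class $\Pi$ is a set $T$ of labelled examples consistent with $\pi$ such that every $\tau\in\Pi$ consistent with $T$ has $L(\tau)=L(\pi)$; $\mathrm{TD}(\pi,\Pi)$ is its minimum size and $\mathrm{TD}(\Pi)=\sup_\pi\mathrm{TD}(\pi,\Pi)$. For a strict partial order $\prec$ on $\Pi$, a teaching set for $\pi$ w.r.t. $(\Pi,\prec)$ is a teaching set for $\pi$ w.r.t. $\Pi\setminus\{\pi':\pi'\prec\pi\}$; $\mathrm{PBTD}(\Pi,\prec)$ is the supremum over $\pi$ of the minimum size of such sets, and $\mathrm{PBTD}(\Pi)=\inf_\prec\mathrm{PBTD}(\Pi,\prec)$.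 *)

(* Defs.v *)
From mathcomp Require Import all_boot.
Set Implicit Arguments. Unset Strict Implicit. Unset Printing Implicit Defensive.

Section Patterns.
Variable Sigma : countType.

(* Variables X = nat; a pattern is a finite string over X + Sigma. *)
Definition pattern := seq (nat + Sigma)%type.
Definition word := seq Sigma.

Definition is_var (s : nat + Sigma) : bool := if s is inl _ then true else false.

Definition subst (h : nat -> word) (p : pattern) : word :=
  flatten (map (fun s => match s with inl x => h x | inr a => [:: a] end) p).

Definition inL (p : pattern) (w : word) : Prop := exists h : nat -> word, w = subst h p.

Definition same_lang (p q : pattern) : Prop := forall w, inL p w <-> inL q w.

Definition constant_free (p : pattern) : bool := all is_var p.

Definition quasi_regular (m : nat) (p : pattern) : bool :=
  all (fun s => is_var s ==> (count_mem s p == m)) p.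

Definition QRcf (m : nat) (p : pattern) : Prop :=
  [/\ p != [::], constant_free p & quasi_regular m p].

Definition example := (word * bool)%type.

Definition consistent (p : pattern) (T : seq example) : Prop :=
  forall e, e \in T -> (inL p e.1 <-> e.2 = true).

Definition teaching_set (Pi : pattern -> Prop) (p : pattern) (T : seq example) : Prop :=
  consistent p T /\ (forall t, Pi t -> consistent t T -> same_lang t p).

(* TD(Pi) <= d  (TD(Pi) is the sup over p in Pi of the minimal size) *)
Definition TD_le (Pi : pattern -> Prop) (d : nat) : Prop :=
  forall p, Pi p -> exists T, size T <= d /\ teaching_set Pi p T.

Definition TD_eq (Pi : pattern -> Prop) (d : nat) : Prop :=
  TD_le Pi d /\ forall d', d' < d -> ~ TD_le Pi d'.

(* strict partial order on Pi, where patterns with equal languages are identified *)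
Definition strict_order_on (Pi : pattern -> Prop) (prec : pattern -> pattern -> Prop) : Prop :=
  [/\ forall p, Pi p -> ~ prec p p,
      forall p q r, Pi p -> Pi q -> Pi r -> prec p q -> prec q r -> prec p r
    & forall p p' q q', same_lang p p' -> same_lang q q' -> prec p q -> prec p' q'].

Definition PBTD_ord_le (Pi : pattern -> Prop) (prec : pattern -> pattern -> Prop) (d : nat) : Prop :=
  forall p, Pi p -> exists T, size T <= d /\
    teaching_set (fun t => Pi t /\ ~ prec t p) p T.

(* PBTD(Pi) = inf over strict orders; <= d iff some order achieves <= d *)
Definition PBTD_le (Pi : pattern -> Prop) (d : nat) : Prop :=
  exists prec, strict_order_on Pi prec /\ PBTD_ord_le Pi prec d.

Definition PBTD_eq (Pi : pattern -> Prop) (d : nat) : Prop :=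
  PBTD_le Pi d /\ forall d', d' < d -> ~ PBTD_le Pi d'.

End Patterns.

(* Main.v *)
Require Import Defs.
From Stdlib Require Import Classical.
From mathcomp Require Import all_boot.

(** Let [minlen p] be the least length of a pattern of the class with the
language of [p], and let [t] precede [p] when [minlen p < minlen t]. Every
pattern is then taught by one positive example. Take [q] of minimal length for
the language of [p] and replace each variable [x] of [q] by a word made of more
than [size q] blocks [a b^e c], all exponents being distinct. If the resulting
word lies in the language of [r] with [size r <= size q], the factorisation
according to [r] cuts at most [size r] blocks, so each [x] keeps a block that is
never cut; reading off these blocks gives a morphism mapping [r] to [q]. Since
every variable occurs exactly [m] times in [q] and in [r], the images of the
variables of [r] have no variable in common, and minimality of [q] forces them
to be single variables, so that [r] is a renaming of [q]. *)

Set Implicit Arguments.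
Unset Strict Implicit.
Unset Printing Implicit Defensive.

(** * Concatenated images of sequences and weighted counting *)

Section SequenceMorphisms.

Variables (T U V : eqType).

Lemma map_flatten_map (f : T -> seq U) (g : U -> V) s :
  map g (flatten (map f s)) = flatten (map (fun x => map g (f x)) s).
Proof. by elim: s => //= x s IHs; rewrite map_cat IHs. Qed.

Lemma flatten_map_flatten (f : T -> seq U) (g : U -> seq V) s :
  flatten (map g (flatten (map f s)))
    = flatten (map (fun x => flatten (map g (f x))) s).
Proof. by elim: s => //= x s IHs; rewrite map_cat flatten_cat IHs. Qed.

Lemma filter_flatten_map (P : pred U) (f : T -> seq U) s :
  filter P (flatten (map f s)) = flatten (map (fun x => filter P (f x)) s).
Proof. by elim: s => //= x s IHs; rewrite filter_cat IHs. Qed.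

Lemma filter_flatten (P : pred T) s :
  filter P s = flatten (map (fun x => if P x then [:: x] else [::]) s).
Proof. by elim: s => //= x s ->; case: (P x). Qed.

Lemma flatten_map1_in (f : T -> seq U) (g : T -> U) s :
  {in s, forall x, f x = [:: g x]} -> flatten (map f s) = map g s.
Proof.
move=> fg; rewrite (eq_in_map f (fun x => [:: g x]) s).1 //.
by elim: s {fg} => //= x s ->.
Qed.

Lemma leq_count_sumn (f : T -> nat) y s :
  count_mem y s * f y <= sumn (map f s).
Proof.
elim: s => //= x s IHs; rewrite mulnDl leq_add //.
by case: eqP => [->|_]; rewrite ?mul1n.
Qed.

Lemma leq_count2_sumn (f : T -> nat) y z s : y != z ->
  count_mem y s * f y + count_mem z s * f z <= sumn (map f s).
Proof.
move=> yz; elim: s => //= x s IHs.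
rewrite !mulnDl addnACA leq_add //.
case: (eqVneq x y) => [->|_]; first by rewrite (negPf yz) mul1n mul0n addn0.
by case: eqP => [->|_]; rewrite ?mul1n.
Qed.

Lemma sumn_full (f : T -> nat) s : (forall y, f y <= 1) ->
  size s <= sumn (map f s) -> {in s, forall y, f y = 1}.
Proof.
move=> f1; elim: s => //= x s IHs le_s.
have le_sum : sumn (map f s) <= size s.
  by elim: s {IHs le_s} => //= y s; rewrite -add1n; apply: leq_add.
have [fx|fx] : f x = 1 \/ f x = 0 by have := f1 x; case: (f x) => [|[]]; auto.
- move=> y; rewrite inE => /orP [/eqP -> //|]; apply: IHs.
  by rewrite fx add1n in le_s.
- by rewrite fx add0n ltnNge le_sum in le_s.
Qed.

End SequenceMorphisms.

(** * Constant-free patterns as sequences of variables *)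

Section Words.

Variable Sigma : countType.
Implicit Types (s r q : seq nat) (w : word Sigma).

Definition var_pattern s : pattern Sigma := map inl s.

Definition regular m s := s != [::] /\ {in s, forall x, count_mem x s = m}.

Lemma constant_freeP (p : pattern Sigma) :
  constant_free p -> exists s, p = var_pattern s.
Proof.
elim: p => [|[x|a] p IHp] //=; first by exists [::].
by move=> /IHp [s ->]; exists (x :: s).
Qed.

Lemma count_var_pattern x s : count_mem (inl x) (var_pattern s) = count_mem x s.
Proof. by rewrite count_map; apply: eq_count. Qed.

Lemma QRcf_var_pattern m s : QRcf m (var_pattern s) <-> regular m s.
Proof.
split=> [[s0 _ /allP qr]|[s0 qr]]; split; first by case: s s0 {qr}.
- move=> x xs; have /qr /eqP : inl x \in var_pattern s by apply: map_f.
  by rewrite count_var_pattern.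
- by case: s s0 {qr}.
- by rewrite /constant_free all_map; apply/allP.
- by apply/allP => _ /mapP [x xs ->] /=; rewrite count_var_pattern qr.
Qed.

Lemma QRcfP m (p : pattern Sigma) :
  QRcf m p -> exists2 s, p = var_pattern s & regular m s.
Proof.
move=> qp; have [_ /constant_freeP [s ps] _] := qp.
by exists s; rewrite // -QRcf_var_pattern -ps.
Qed.

Lemma subst_var_pattern h s :
  subst h (var_pattern s) = flatten (map h s) :> word Sigma.
Proof. by rewrite /subst -map_comp. Qed.

Lemma inL_var_pattern s w :
  inL (var_pattern s) w <-> exists h, w = flatten (map h s).
Proof. by split=> -[h ->]; exists h; rewrite subst_var_pattern. Qed.

Lemma inL_morphism (f : nat -> seq nat) s w :
  inL (var_pattern (flatten (map f s))) w -> inL (var_pattern s) w.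
Proof.
move=> /inL_var_pattern [h ->]; apply/inL_var_pattern.
by exists (fun x => flatten (map h (f x))); rewrite flatten_map_flatten.
Qed.

Lemma same_lang_sym (p q : pattern Sigma) : same_lang p q -> same_lang q p.
Proof. by move=> pq w; rewrite pq. Qed.

Lemma same_lang_trans (p q t : pattern Sigma) :
  same_lang p q -> same_lang q t -> same_lang p t.
Proof. by move=> pq qt w; rewrite pq. Qed.

(** * Morphisms from [r] onto a shortest pattern [q] *)

Section MorphismOntoShortest.

Variables (m : nat) (r : seq nat) (f : nat -> seq nat).

Let q := flatten (map f r).

Hypotheses (reg_q : regular m q) (reg_r : regular m r).

Lemma mem_image x y : y \in r -> x \in f y -> x \in q.
Proof. by move=> yr xy; apply/flatten_mapP; exists y. Qed.

Lemma sumn_count_image x y : y \in r -> x \in f y ->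
  0 < m /\ sumn [seq count_mem x (f z) | z <- r] = m.
Proof.
move=> yr xy; split.
  by rewrite -(reg_r.2 _ yr) -has_count has_pred1.
by rewrite -(reg_q.2 _ (mem_image yr xy)) /q count_flatten -map_comp.
Qed.

(** The variable [y] occurs [m] times in [r], so each copy of [x] in [f y] yields [m] occurrences of
    [x] in [q], where only [m] are available. *)
Lemma uniq_image y : y \in r -> uniq (f y).
Proof.
move=> yr; apply: count_mem_uniq => x.
have [xy|/count_memPn //] := boolP (x \in f y).
have [m0 sm] := sumn_count_image yr xy; apply/eqP.
rewrite eqn_leq -has_count has_pred1 xy andbT -(leq_pmul2l m0) muln1 -[X in _ <= X]sm.
by rewrite -{1}(reg_r.2 _ yr) (leq_count_sumn (fun z => count_mem x (f z))).
Qed.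

(** A variable shared by the images of two distinct variables of [r] would occur at least [2m] times
    in [q]. *)
Lemma image_disjoint x y z :
  y \in r -> z \in r -> x \in f y -> x \in f z -> y = z.
Proof.
move=> yr zr xy xz; apply/eqP; apply: contraT => yz.
have [m0 sm] := sumn_count_image yr xy.
have := leq_count2_sumn (fun z => count_mem x (f z)) r yz.
rewrite sm !reg_r.2 // -mulnDr leqNgt -{1}[m]muln1 ltn_pmul2l //.
have cpos u : x \in f u -> 0 < count_mem x (f u) by rewrite -has_count has_pred1.
by rewrite -addn1 leq_add ?cpos.
Qed.

(** By [image_disjoint] the owner of a variable of [q] is unique; the default 0 arises only for
    variables absent from [q]. *)
Let owner x := nth 0 r (find (fun y => x \in f y) r).

Lemma ownerE x y : y \in r -> x \in f y -> owner x = y.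
Proof.
move=> yr xy; have hr : has (fun y => x \in f y) r by apply/hasP; exists y.
apply: (image_disjoint (x := x)) => //; first by rewrite mem_nth -?has_find.
exact: (nth_find 0 hr).
Qed.

Let leader x := x == head 0 (f (owner x)).

Lemma take1_image y : y \in r -> take 1 (f y) = filter leader (f y).
Proof.
move=> yr; have own x : x \in f y -> owner x = y by exact: ownerE.
rewrite (eq_in_filter (a2 := pred1 (head 0 (f y)))).
  have := uniq_image yr; case: (f y) => //= x t /andP [xt _].
  rewrite take0 eqxx; congr cons; apply/esym/eqP; rewrite -(negbK (_ == _)) -has_filter.
  by rewrite has_pred1.
by move=> x xy; rewrite /= /leader own.
Qed.

Let q' := filter leader q.

Lemma leadersE : q' = flatten (map (fun y => take 1 (f y)) r).
Proof.
by rewrite /q' /q filter_flatten_map; congr flatten; apply/eq_in_map => y /take1_image ->.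
Qed.

Lemma leaders_expand : flatten (map (fun x => f (owner x)) q') = q.
Proof.
rewrite leadersE flatten_map_flatten /q; congr flatten.
apply/eq_in_map => y yr; have := @ownerE _ y yr.
by case E: (f y) => [|x t] //= own; rewrite take0 /= own ?mem_head // cats0.
Qed.

(** Being a leader depends on the variable alone, so filtering keeps all occurrences of a variable
    or none. The result is nonempty because it expands back to [q]. *)
Lemma regular_leaders : regular m q'.
Proof.
split; first by apply/eqP => q'0; have /eqP := reg_q.1; rewrite -leaders_expand q'0.
move=> x; rewrite mem_filter => /andP [lx xq].
rewrite count_filter -(reg_q.2 _ xq); apply: eq_count => y /=.
by case: eqP => [->|].
Qed.

(** Morphisms exist both ways: erasing the other variables maps [q] to [q'], and replacing each
    leader by the whole image it heads maps [q'] to [q]. *)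
Lemma same_lang_leaders : same_lang (var_pattern q') (var_pattern q).
Proof.
move=> w; split; first by rewrite /q' filter_flatten; apply: inL_morphism.
by rewrite -{1}leaders_expand; apply: inL_morphism.
Qed.

(** Each position of [r] contributes at most one leader, while minimality of [q] gives
    [size r <= size q']. Hence each contributes exactly one, and [owner] renames [q'] to [r]. *)
Lemma morphism_onto_shortest :
    (forall s, regular m s -> same_lang (var_pattern s) (var_pattern q) ->
       size q <= size s) ->
    size r <= size q ->
  same_lang (var_pattern r) (var_pattern q).
Proof.
move=> minq le_rq w; split; last exact: inL_morphism.
move=> wr; rewrite -same_lang_leaders.
have le_rq' := leq_trans le_rq (minq _ regular_leaders same_lang_leaders).
suff rE : r = flatten (map (fun x => [:: owner x]) q').
  by move: wr; rewrite {1}rE; apply: inL_morphism.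
rewrite leadersE flatten_map_flatten -[LHS]map_id; apply/esym.
apply: flatten_map1_in => y yr.
have size1 : size (take 1 (f y)) = 1.
  apply: (sumn_full (f := fun y => size (take 1 (f y))) _ _ yr).
    by move=> z; rewrite size_take; case: (ltnP 1 (size (f z))).
  by move: le_rq'; rewrite leadersE size_flatten /shape -map_comp.
have := @ownerE _ y yr; move: size1.
by case: (f y) => //= x t _ own; rewrite take0 /= own ?mem_head.
Qed.

End MorphismOntoShortest.

(** * Coding variables by blocks that survive a factorisation *)

Section Blocks.

Variables a b c : Sigma.
Hypotheses (ab : a != b) (ac : a != c) (bc : b != c).

Definition block e : word Sigma := a :: rcons (nseq e b) c.

(* Reads the exponents of the factors [a b^e c]; the state [Some k] means that
   the letters just read are [a b^k]. *)
Fixpoint scan (st : option nat) w : seq nat :=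
  if w is x :: w' then
    if x == a then scan (Some 0) w'
    else if st is Some k then
      if x == b then scan (Some k.+1) w'
      else if x == c then k :: scan None w' else scan None w'
    else scan None w'
  else [::].

Fixpoint scan_state (st : option nat) w : option nat :=
  if w is x :: w' then
    if x == a then scan_state (Some 0) w'
    else if st is Some k then
      if x == b then scan_state (Some k.+1) w' else scan_state None w'
    else scan_state None w'
  else st.

Lemma scan_cat st w w' :
  scan st (w ++ w') = scan st w ++ scan (scan_state st w) w'.
Proof.
elim: w st => //= x w IHw st; case: (x == a) => //; case: st => [k|] //.
by case: (x == b) => //; case: (x == c); rewrite IHw.
Qed.

(** An inherited unfinished block can be completed at most once; after the next [a] or the first
    letter other than [b], both scans agree. *)
Lemma scan_start st w : exists2 E, size E <= 1 & scan st w = E ++ scan None w.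
Proof.
elim: w st => [|x w IHw] st; first by exists [::].
case: st => [k|] /=; last by exists [::].
case: (x == a); first by exists [::].
case: (x == b); first exact: IHw.
by case: (x == c); [exists [:: k] | exists [::]].
Qed.

(** [E] collects the exponents of blocks straddling factor boundaries. Once these are filtered out,
    scanning commutes with concatenation. *)
Lemma scan_flatten (g : nat -> word Sigma) s : exists2 E, size E <= size s &
  forall P : pred nat, ~~ has P E ->
    filter P (scan None (flatten (map g s)))
      = flatten (map (fun y => filter P (scan None (g y))) s).
Proof.
elim: s => [|y s [E sE EP]]; first by exists [::].
have [F sF FE] := scan_start (scan_state None (g y)) (flatten (map g s)).
exists (F ++ E) => /= [|P]; first by rewrite size_cat -add1n leq_add.
rewrite has_cat negb_or => /andP [PF /EP <-].
by rewrite scan_cat filter_cat FE filter_cat (_ : filter P F = [::]) //; apply/eqP; rewrite -(negbK (_ == _)) -has_filter.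
Qed.

Lemma scan_block e w : scan None (block e ++ w) = e :: scan None w.
Proof.
rewrite /= eqxx -[e in RHS]add0n.
elim: e 0 => [|e IHe] k /=.
  by rewrite eq_sym (negPf ac) eq_sym (negPf bc) eqxx addn0.
by rewrite eq_sym (negPf ab) eqxx IHe addSnnS.
Qed.

Lemma scan_blocks s : scan None (flatten (map block s)) = s.
Proof. by elim: s => // e s IHs; rewrite [map _ _]/= [flatten _]/= scan_block IHs. Qed.

(** The exponents for distinct [x] fill disjoint intervals of length [K], so division by [K]
    recovers [x]. *)
Definition code K x : word Sigma := flatten (map block (iota (x * K) K)).

Lemma code_morphism K s r : size r < K ->
    inL (var_pattern r) (flatten (map (code K) s)) ->
  exists f, s = flatten (map f r).
Proof.
move=> ltrK /inL_var_pattern [g gE].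
have [E sE EP] := scan_flatten g r.
(* At most [size r < K] exponents are cut, so by pigeonhole the [K] blocks of [x] include an uncut
   one. *)
have free x : exists2 e, e \in iota (x * K) K & e \notin E.
  apply/hasP; rewrite has_predC; apply/negP => /allP sub.
  have := uniq_leq_size (iota_uniq _ _) sub.
  by rewrite size_iota leqNgt (leq_ltn_trans sE).
pose good x := head 0 [seq e <- iota (x * K) K | e \notin E].
have goodP x : good x \in [seq e <- iota (x * K) K | e \notin E].
  have [e eK eE] := free x; rewrite /good.
  have : e \in [seq e <- iota (x * K) K | e \notin E] by rewrite mem_filter eE.
  by case: (filter _ _) => //= e' t _; rewrite mem_head.
(* [P] selects one uncut exponent per variable, so each occurrence of [x] in [s] is read exactly
   once. *)
pose P e := e == good (e %/ K).
have divK x e : e \in iota (x * K) K -> e %/ K = x.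
  rewrite mem_iota => /andP [le_e lt_e].
  by rewrite -(subnKC le_e) divnMDl ?(leq_ltn_trans _ ltrK) // divn_small ?addn0 // ltn_subLR.
have PE : ~~ has P E.
  apply/hasPn => e eE; apply/eqP => ee.
  by have := goodP (e %/ K); rewrite -ee mem_filter eE.
have Pcode x : filter P (iota (x * K) K) = [:: good x].
  have := goodP x; rewrite mem_filter => /andP [_ gx].
  rewrite (eq_in_filter (a2 := pred1 (good x))) ?filter_pred1_uniq ?iota_uniq //.
  by move=> e /divK ex; rewrite /P ex.
exists (fun y => [seq e %/ K | e <- filter P (scan None (g y))]).
have codeE : flatten (map (code K) s)
    = flatten (map block (flatten (map (fun x => iota (x * K) K) s))).
  by rewrite flatten_map_flatten.
rewrite -map_flatten_map -EP // -gE codeE scan_blocks filter_flatten_map.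
rewrite (flatten_map1_in (g := good)) // -map_comp -[LHS]map_id.
apply: eq_map => x /=; rewrite (divK x) //.
by have := goodP x; rewrite mem_filter => /andP [].
Qed.

End Blocks.

(** * The preference order and teaching by one positive example *)

Definition shorter_lang m (t p : pattern Sigma) : Prop :=
  exists2 q : pattern Sigma, QRcf m q /\ same_lang q p &
    forall u, QRcf m u -> same_lang u t -> size q < size u.

(** [shorter_lang] compares minimal lengths without computing them: a witness for the language of
    [p] is shorter than every class member with the language of [t]. Irreflexivity compares the
    witness with itself. *)
Lemma shorter_lang_order m : strict_order_on (@QRcf Sigma m) (shorter_lang m).
Proof.
split.
- by move=> p _ [q [qq qp] /(_ q qq qp)]; rewrite ltnn.
- move=> p q t _ _ _ [q' [qq' q'q] ltp] [t' [qt' t't] ltq].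
  by exists t' => // s qs sp; apply: ltn_trans (ltq _ qq' q'q) (ltp _ qs sp).
- move=> p p' q q' pp' qq' [t [qt tq] ltp].
  exists t; first by split=> //; apply: same_lang_trans tq qq'.
  move=> s qs sp'; apply: ltp => //.
  by apply: same_lang_trans sp' _; apply: same_lang_sym.
Qed.

Lemma shortest_pattern m (p : pattern Sigma) : QRcf m p ->
  exists q, [/\ regular m q, same_lang (var_pattern q) p &
    forall s, regular m s -> same_lang (var_pattern s) (var_pattern q) ->
      size q <= size s].
Proof.
move=> /QRcfP [s0 -> reg0].
have [n] := ubnP (size s0); elim: n => // n IHn in s0 reg0 *.
rewrite ltnS => le_n.
case: (classic (exists s, [/\ regular m s,
  same_lang (var_pattern s) (var_pattern s0) & size s < size s0])).
- move=> [s [regs ss0 lt_s]].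
  have [q [regq qs minq]] := IHn s regs (leq_trans lt_s le_n).
  by exists q; split=> //; apply: same_lang_trans qs ss0.
- move=> no; exists s0; split=> // s regs ss0; rewrite leqNgt; apply/negP => lt_s.
  by apply: no; exists s.
Qed.

Lemma PBTD_le1 m (a b c : Sigma) : a != b -> a != c -> b != c ->
  PBTD_le (@QRcf Sigma m) 1.
Proof.
move=> ab ac bc; exists (shorter_lang m); split; first exact: shorter_lang_order.
move=> p qp; have [q [regq qp_lang minq]] := shortest_pattern qp.
pose w := flatten (map (code a b c (size q).+1) q).
exists [:: (w, true)]; split=> //; split.
  move=> e; rewrite inE => /eqP -> /=; split=> // _; apply/qp_lang/inL_var_pattern.
  by eexists.
move=> t [qt not_prec] /(_ (w, true) (mem_head _ _)) [_ /(_ erefl) /= wt].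
(* If every class member with the language of [t] were longer than [q], then [q] would witness that
   [t] precedes [p]. *)
have [r regr [rt le_rq]] : exists2 r, regular m r &
    same_lang (var_pattern r) t /\ size r <= size q.
  apply: NNPP => no; apply: not_prec; exists (var_pattern q).
    by split=> //; apply/QRcf_var_pattern.
  move=> _ /QRcfP [r -> regr] rt; rewrite !size_map ltnNge; apply/negP => le_rq.
  by apply: no; exists r.
move: wt; rewrite -rt => wr.
have [f qE] := code_morphism ab ac bc (le_rq : size r < (size q).+1) wr.
apply: same_lang_trans (same_lang_sym rt) _.
apply: same_lang_trans qp_lang.
move: regq minq le_rq; rewrite qE => regq minq le_rq.
exact: (morphism_onto_shortest regq regr).
Qed.

(** * The lower bound for [m >= 2] *)

Lemma regular_nseq m : 0 < m -> regular m (nseq m 0).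
Proof.
move=> m0; split=> [|x]; first by case: m m0.
by rewrite mem_nseq => /andP [_ /eqP ->]; rewrite count_nseq mul1n.
Qed.

Lemma regular_nseq2 m : 0 < m -> regular m (nseq m 0 ++ nseq m 1).
Proof.
move=> m0; split=> [|x]; first by case: m m0.
rewrite mem_cat !mem_nseq count_cat !count_nseq /=.
by move=> /orP [] /andP [_ /eqP ->]; rewrite mul1n ?addn0.
Qed.

(** The word [a^m b^m] separates the languages: as an [m]-th power its root would have length 2 and,
    since [m >= 2], equal [aa], leaving no room for [b]. *)
Lemma distinct_langs m (a b : Sigma) : 1 < m -> a != b ->
  ~ same_lang (var_pattern (nseq m 0)) (var_pattern (nseq m 0 ++ nseq m 1)).
Proof.
move=> m1 ab same.
pose h x : word Sigma := [:: if x == 0 then a else b].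
have hE : flatten (map h (nseq m 0 ++ nseq m 1)) = nseq m a ++ nseq m b.
  by rewrite (flatten_map1_in (g := fun x => if x == 0 then a else b)) // map_cat !map_nseq.
have /same /inL_var_pattern [g] :
    inL (var_pattern (nseq m 0 ++ nseq m 1)) (nseq m a ++ nseq m b).
  by apply/inL_var_pattern; exists h.
rewrite map_nseq => gE.
have sg : size (g 0) = 2.
  have := congr1 size gE.
  rewrite size_cat !size_nseq size_flatten /shape map_nseq sumn_nseq addnn -muln2 mulnC.
  by move/eqP; rewrite eqn_pmul2r ?(ltnW m1) // => /eqP.
case: m m1 gE {same hE} => [|[|n]] // _ /=; case: (g 0) sg => [|x [|y []]] //= _ [<- <-].
move=> gE; have : b \in nseq n a ++ [:: b, b & nseq n b].
  by rewrite mem_cat mem_head orbT.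
rewrite gE -[X in _ \in X]/(flatten (nseq n.+1 [:: a; a])) => /flattenP [u].
by rewrite mem_nseq => /andP [_ /eqP ->]; rewrite !inE orbb eq_sym (negPf ab).
Qed.

(** If the empty set teaches [u], every class member with another language precedes [u]. Two
    patterns with distinct languages would then precede each other. *)
Lemma PBTD_not_le0 m (a b : Sigma) : 1 < m -> a != b ->
  ~ PBTD_le (@QRcf Sigma m) 0.
Proof.
move=> m1 ab [prec [[irr trans _] le0]].
have m0 := ltnW m1.
set p := var_pattern (nseq m 0); set q := var_pattern (nseq m 0 ++ nseq m 1).
have qp : QRcf m p by apply/QRcf_var_pattern/regular_nseq.
have qq : QRcf m q by apply/QRcf_var_pattern/regular_nseq2.
have teach0 t u : QRcf m t -> QRcf m u -> ~ same_lang t u -> prec t u.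
  move=> qt qu tu; apply: NNPP => not_tu; apply: tu.
  have [T []] := le0 u qu; rewrite leqn0 size_eq0 => /eqP -> [_ teach].
  exact: teach.
have pq := distinct_langs m1 ab.
apply: (irr p qp); apply: (trans p q p) => //; apply: teach0 => //.
by move=> /same_lang_sym.
Qed.

(** * The case [m = 1], where all languages coincide *)

Lemma inL_QRcf1 (p : pattern Sigma) w : QRcf 1 p -> inL p w.
Proof.
move=> /QRcfP [[|x s] -> [] // _ /(_ x (mem_head _ _)) /=].
rewrite eqxx => -[] /eqP; rewrite -leqn0 leqNgt -has_count has_pred1 => xs.
(* The first variable occurs only once, so it can carry all of [w] while the others are erased. *)
apply/(inL_var_pattern (x :: s)); exists (fun y => if y == x then w else [::]).
rewrite /= eqxx; elim: s xs => [|y s IHs] /=; first by rewrite cats0.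
by rewrite inE negb_or eq_sym => /andP [/negPf -> /IHs].
Qed.

Lemma teaching_set_nil_QRcf1 (Pi : pattern Sigma -> Prop) p :
  (forall t, Pi t -> QRcf 1 t) -> QRcf 1 p -> teaching_set Pi p [::].
Proof.
move=> Pi1 qp; split=> // t /Pi1 qt _ w.
by split=> _; apply: inL_QRcf1.
Qed.

End Words.

Theorem mainTheorem9 :
  (forall Sigma : countType, inhabited Sigma ->
     TD_eq (@QRcf Sigma 1) 0 /\ PBTD_eq (@QRcf Sigma 1) 0) /\
  (forall (Sigma : countType) (m : nat), 2 <= m ->
     (exists f : 'I_(4 * m ^ 2 + 1) -> Sigma, injective f) ->
     PBTD_eq (@QRcf Sigma m) 1).
Proof.
split=> [Sigma _|Sigma m m2 [f injf]].
  split; split=> //.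
    by move=> p qp; exists [::]; split=> //; apply: teaching_set_nil_QRcf1.
  exists (fun _ _ => False); split; first by split=> [? _ []||].
  by move=> p qp; exists [::]; split=> //; apply: teaching_set_nil_QRcf1 => // t [].
have lt2 : 2 < 4 * m ^ 2 + 1.
  rewrite addn1 ltnS; apply: (@leq_trans (4 * 1)) => //.
  by rewrite leq_pmul2l // expn_gt0 (ltnW m2).
(* The first three values of [f] serve as the block letters [a], [b], [c]. *)
pose letter i (lti : i < 3) := f (Ordinal (leq_trans lti lt2)).
have letterP i j lti ltj : i != j -> @letter i lti != @letter j ltj.
  by apply: contraNneq => /injf [->].
have ab : @letter 0 isT != @letter 1 isT by apply: letterP.
split; last by case=> // _; apply: PBTD_not_le0 m2 ab.
by apply: (@PBTD_le1 _ _ (@letter 0 isT) (@letter 1 isT) (@letter 2 isT)); apply: letterP.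
Qed.
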